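(* Let $\mathbb X^{(1)},\mathbb X^{(2)}\in\Omega^p_T$ and let $\mathbb X$ be their concatenation at $\theta$, $$\mathbb X_{0,t}=\mathbf 1_{\{t<\theta\}}\,\mathbb X^{(1)}_{0,t}+\mathbf 1_{\{t\ge\theta\}}\,\big(\mathbb X^{(1)}_{0,\theta}\otimes\mathbb X^{(2)}_{\theta,t}\big),\qquad t\in[0,T].$$ For every given $\theta$ and every $t\in(\theta,T]$, $$d_{p\text{-var};[0,t]}\big(\mathbb X,\mathbb X^{(1)}\big)=d_{p\text{-var};[\theta,t]}\big(\mathbb X,\mathbb X^{(1)}\big).$$
   Context: Fix $d\ge1$, $p\ge1$, $T>0$, $N=\lfloor p\rfloor$; $\theta\ge 0$. $G^N(\mathbb R^d)$ is the free step-$N$ nilpotent group inside the truncated tensor algebra, with product $\otimes$ and identity $\mathbf 1$; $S_N(x)_{s,t}$ is the step-$N$ truncated signature (iterated integrals) of a continuous bounded variation path $x$ over $[s,t]$. The Carnot–Carathéodory norm is $\|g\|_{CC}=\inf\{\text{length}(\gamma):\gamma\in C^{1\text{-var}}([0,1],\mathbb R^d),\ S_N(\gamma)_{0,1}=g\}$ and $d_{CC}(g,h)=\|g^{-1}\otimes h\|_{CC}$. For continuous $\mathbb X,\mathbb Y:[0,T]\to G^N(\mathbb R^d)$ with $\mathbb X_0=\mathbb Y_0=\mathbf 1$, $\mathbb X_{s,t}:=\mathbb X_s^{-1}\otimes\mathbb X_t$ and $d_{p\text{-var};[s,t]}(\mathbb X,\mathbb Y)=\big(\sup_{\mathcal D\subset[s,t]}\sum_i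 d_{CC}(\mathbb X_{t_i,t_{i+1}},\mathbb Y_{t_i,t_{i+1}})^p\big)^{1/p}$, the supremum being over partitions $\mathcal D=\{s=t_0<\dots<t_m=t\}$ of $[s,t]$. $\Omega_T^p$ is the set of geometric $p$-rough paths: continuous $\mathbb X:[0,T]\to G^N(\mathbb R^d)$ with $\mathbb X_0=\mathbf 1$, finite homogeneous $p$-variation, and for which there exist bounded variation paths $x^m$ with $d_{p\text{-var};[0,T]}(S_N(x^m),\mathbb X)\to0$. *)

(* Defs.v *)
From HB Require Import structures.
From mathcomp Require Import all_boot all_order all_algebra.
From mathcomp Require Import all_classical all_reals all_analysis.

Set Implicit Arguments.
Unset Strict Implicit.
Unset Printing Implicit Defensive.

Import Order.TTheory GRing.Theory Num.Theory.
Import numFieldNormedType.Exports.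

Local Open Scope classical_set_scope.
Local Open Scope ring_scope.

(* An element of K (+) K^d (+) ... (+) (K^d)^{(x)N} is given by its coordinates
   in the canonical basis e_{i1} (x) ... (x) e_{ik}, k <= N, that is by one
   scalar for each word i1 ... ik of length at most N. *)
Definition ttensor (K : fieldType) (N d : nat) : Type :=
  {ffun N.-bseq 'I_d -> K^o}.

HB.instance Definition _ (K : fieldType) N d :=
  GRing.Lmodule.copy (ttensor K N d) {ffun N.-bseq 'I_d -> K^o}.

Section TruncatedTensorAlgebra.
Variables (K : fieldType) (N d : nat).
Implicit Types (w : seq 'I_d) (g h : ttensor K N d) (f : seq 'I_d -> K).

Definition conv f1 f2 w : K :=
  \sum_(i < (size w).+1) f1 (take i w) * f2 (drop i w).

Definition tcoef g w : K := oapp (fun b : N.-bseq 'I_d => g b : K) 0 (insub w).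

Definition tens_mul g h : ttensor K N d :=
  [ffun w : N.-bseq 'I_d => conv (tcoef g) (tcoef h) w].

Definition tens_one : ttensor K N d :=
  [ffun w : N.-bseq 'I_d => (size w == 0%N)%:R].

Lemma tcoefE g (w : N.-bseq 'I_d) : tcoef g w = g w.
Proof. by rewrite /tcoef valK. Qed.

Lemma tcoef_oversize g w : (N < size w)%N -> tcoef g w = 0.
Proof. by move=> Nw; rewrite /tcoef insubF// leqNgt Nw. Qed.

Lemma tcoefP g h :
  (forall w, (size w <= N)%N -> tcoef g w = tcoef h w) -> g = h.
Proof. by move=> gh; apply/ffunP => w; rewrite -!tcoefE gh ?size_bseq. Qed.

Lemma tcoefD g h w : tcoef (g + h) w = tcoef g w + tcoef h w.
Proof.
by rewrite /tcoef; case: insubP => [b _ _|_] /=; rewrite ?ffunE ?addr0.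
Qed.

Lemma tcoefZ a g w : tcoef (a *: g) w = a * tcoef g w.
Proof.
by rewrite /tcoef; case: insubP => [b _ _|_] /=; rewrite ?ffunE ?mulr0.
Qed.

Lemma tcoef_one w : tcoef tens_one w = (size w == 0%N)%:R.
Proof.
rewrite /tcoef; case: insubP => [b _ <-|] /=; first by rewrite ffunE.
by rewrite -ltnNge; case: (size w).
Qed.

Lemma tcoefM g h w : (size w <= N)%N ->
  tcoef (tens_mul g h) w = conv (tcoef g) (tcoef h) w.
Proof. by move=> wN; rewrite {1}/tcoef insubT/= ffunE. Qed.

Lemma conv_nil f1 f2 : conv f1 f2 [::] = f1 [::] * f2 [::].
Proof. by rewrite /conv big_ord_recl big_ord0 addr0. Qed.

Lemma conv_cons f1 f2 x w :
  conv f1 f2 (x :: w) = f1 [::] * f2 (x :: w) + conv (f1 \o cons x) f2 w.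
Proof. by rewrite /conv big_ord_recl. Qed.

Lemma eq_conv_le n f1 f2 f1' f2' w : (size w <= n)%N ->
  (forall v, (size v <= n)%N -> f1 v = f1' v) ->
  (forall v, (size v <= n)%N -> f2 v = f2' v) ->
  conv f1 f2 w = conv f1' f2' w.
Proof.
move=> wn e1 e2; apply: eq_bigr => i _; congr (_ * _).
  by apply: e1; rewrite size_take_min (leq_trans (geq_minr _ _)).
by apply: e2; rewrite size_drop (leq_trans (leq_subr _ _)).
Qed.

Lemma convDl f1 f1' f2 w :
  conv (fun v => f1 v + f1' v) f2 w = conv f1 f2 w + conv f1' f2 w.
Proof. by rewrite /conv -big_split; apply: eq_bigr => i _; rewrite mulrDl. Qed.

Lemma convDr f1 f2 f2' w :
  conv f1 (fun v => f2 v + f2' v) w = conv f1 f2 w + conv f1 f2' w.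
Proof. by rewrite /conv -big_split; apply: eq_bigr => i _; rewrite mulrDr. Qed.

Lemma convZl a f1 f2 w : conv (fun v => a * f1 v) f2 w = a * conv f1 f2 w.
Proof. by rewrite /conv mulr_sumr; apply: eq_bigr => i _; rewrite mulrA. Qed.

Lemma convZr a f1 f2 w : conv f1 (fun v => a * f2 v) w = a * conv f1 f2 w.
Proof. by rewrite /conv mulr_sumr; apply: eq_bigr => i _; rewrite mulrCA. Qed.

Lemma convA f1 f2 f3 w : conv f1 (conv f2 f3) w = conv (conv f1 f2) f3 w.
Proof.
elim: w f1 => [|x w IH] f1; first by rewrite !conv_nil mulrA.
rewrite !conv_cons conv_nil mulrDr -addrA mulrA; congr (_ + _).
rewrite IH -convZl -convDl; apply: (@eq_conv_le (size w)) => // v _ /=.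
by rewrite conv_cons.
Qed.

Lemma tens_mulA : associative tens_mul.
Proof.
move=> g1 g2 g3; apply: tcoefP => w wN; rewrite !tcoefM//.
transitivity (conv (tcoef g1) (conv (tcoef g2) (tcoef g3)) w).
  by apply: (@eq_conv_le N) => // v vN; rewrite tcoefM.
by rewrite convA; apply: (@eq_conv_le N) => // v vN; rewrite tcoefM.
Qed.

Lemma tens_mul1 : left_id tens_one tens_mul.
Proof.
move=> g; apply: tcoefP => w wN; rewrite tcoefM// /conv big_ord_recl/=.
rewrite take0 drop0 tcoef_one eqxx mul1r big1 ?addr0// => i _.
by rewrite tcoef_one size_takel ?mul0r//; exact: (ltn_ord i).
Qed.

Lemma tens_mulr1 : right_id tens_one tens_mul.
Proof.
move=> g; apply: tcoefP => w wN; rewrite tcoefM// /conv big_ord_recr/=.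
rewrite take_size drop_size tcoef_one eqxx mulr1 big1 ?add0r// => i _.
by rewrite tcoef_one size_drop subn_eq0 leqNgt ltn_ord mulr0.
Qed.

Lemma tens_mulDl : left_distributive tens_mul +%R.
Proof.
move=> g1 g2 g3; apply: tcoefP => w wN; rewrite tcoefD !tcoefM// -convDl.
by apply: (@eq_conv_le N) => // v _; rewrite tcoefD.
Qed.

Lemma tens_mulDr : right_distributive tens_mul +%R.
Proof.
move=> g1 g2 g3; apply: tcoefP => w wN; rewrite tcoefD !tcoefM// -convDr.
by apply: (@eq_conv_le N) => // v _; rewrite tcoefD.
Qed.

Lemma tens_one_neq0 : tens_one != 0.
Proof.
apply/eqP => /ffunP/(_ [bseq])/eqP; rewrite !ffunE/=.
by rewrite oner_eq0.
Qed.

HB.instance Definition _ := GRing.Zmodule_isNzRing.Build (ttensor K N d)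
  tens_mulA tens_mul1 tens_mulr1 tens_mulDl tens_mulDr tens_one_neq0.

Lemma tens_scaleAl a g h : a *: (g * h) = (a *: g) * h.
Proof.
apply: tcoefP => w wN; rewrite tcoefZ !tcoefM// -convZl.
by apply: (@eq_conv_le N) => // v _; rewrite tcoefZ.
Qed.

HB.instance Definition _ :=
  GRing.Lmodule_isLalgebra.Build K (ttensor K N d) tens_scaleAl.

Lemma tens_scaleAr a g h : a *: (g * h) = g * (a *: h).
Proof.
apply: tcoefP => w wN; rewrite tcoefZ !tcoefM// -convZr.
by apply: (@eq_conv_le N) => // v _; rewrite tcoefZ.
Qed.

HB.instance Definition _ :=
  GRing.Lalgebra_isAlgebra.Build K (ttensor K N d) tens_scaleAr.

Lemma tcoefX_small g k w : tcoef g [::] = 0 -> (size w < k)%N ->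
  tcoef (g ^+ k) w = 0.
Proof.
move=> g0; elim: k w => [//|k IH] w; rewrite ltnS => wk.
have [Nw|wN] := ltnP N (size w); first exact: tcoef_oversize.
rewrite exprS tcoefM// /conv big1// => -[[|i] /= ilt] _.
  by rewrite take0 g0 mul0r.
rewrite IH ?mulr0// size_drop (leq_trans _ wk)// ltn_subrL/=.
by move: ilt; rewrite ltnS; apply: leq_ltn_trans.
Qed.

Definition tens_unit : pred (ttensor K N d) := fun g => tcoef g [::] != 0.

(* Geometric series: 1 - g / c is nilpotent, c being the scalar part of g. *)
Definition tens_inv g : ttensor K N d :=
  let c := tcoef g [::] in
  if c == 0 then g else c^-1 *: \sum_(i < N.+1) (1 - c^-1 *: g) ^+ i.

Lemma tens_nilp g : tens_unit g ->
  (1 - (tcoef g [::])^-1 *: g) ^+ N.+1 = 0 :> ttensor K N d.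
Proof.
move=> g0; apply: tcoefP => w wN; rewrite tcoefX_small ?ltnS//.
  by rewrite /tcoef; case: insubP => //= b _ _; rewrite ffunE.
rewrite tcoefD tcoef_one -scaleNr tcoefZ mulNr mulVf//; exact: subrr.
Qed.

Lemma tens_mulVr : {in tens_unit, left_inverse 1 tens_inv *%R}.
Proof.
move=> g gu; rewrite /tens_inv (negbTE gu) -scalerAl.
set c := tcoef g [::]; set u := 1 - c^-1 *: g.
have -> : g = c *: (1 - u).
  by rewrite opprB addrCA subrr addr0 scalerA mulfV// scale1r.
rewrite -scalerAr scalerA mulVf// scale1r.
have : GRing.comm (\sum_(i < N.+1) u ^+ i) (1 - u).
  apply/commr_sym/commr_sum => i _; apply: commrX; apply: commr_sym.
  by apply: commrB; [exact: commr1|].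
rewrite /GRing.comm => ->; rewrite -opprB mulNr -subrX1.
by rewrite tens_nilp// sub0r opprK.
Qed.

Lemma tens_mulrV : {in tens_unit, right_inverse 1 tens_inv *%R}.
Proof.
move=> g gu; rewrite /tens_inv (negbTE gu) -scalerAr.
set c := tcoef g [::]; set u := 1 - c^-1 *: g.
have -> : g = c *: (1 - u).
  by rewrite opprB addrCA subrr addr0 scalerA mulfV// scale1r.
rewrite -scalerAl scalerA mulVf// scale1r.
by rewrite -opprB mulNr -subrX1 tens_nilp// sub0r opprK.
Qed.

Lemma tens_unitP g h : h * g = 1 /\ g * h = 1 -> tens_unit g.
Proof.
case=> _ /(congr1 (tcoef^~ [::])); rewrite tcoefM// conv_nil tcoef_one eqxx.
rewrite /tens_unit => e; apply: contra_eq_neq e => ->.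
by rewrite mul0r eq_sym oner_neq0.
Qed.

Lemma tens_inv_out : {in [predC tens_unit], tens_inv =1 id}.
Proof. by move=> g; rewrite inE /= /tens_unit negbK /tens_inv => ->. Qed.

HB.instance Definition _ := GRing.NzRing_hasMulInverse.Build (ttensor K N d)
  tens_mulVr tens_mulrV tens_unitP tens_inv_out.

End TruncatedTensorAlgebra.

Section FreeNilpotentGroup.
Variables (K : fieldType) (N d : nat).
Implicit Types x y : ttensor K N d.

Definition tens_vec (v : 'rV[K]_d) : ttensor K N d :=
  [ffun w : N.-bseq 'I_d => if bseqval w is [:: i] then v 0 i else 0 : K].

Inductive lie_elt : ttensor K N d -> Prop :=
| lie_vec v : lie_elt (tens_vec v)
| lie_lin a x y : lie_elt x -> lie_elt y -> lie_elt (a *: x + y)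
| lie_bracket x y : lie_elt x -> lie_elt y -> lie_elt (x * y - y * x).

(* On elements with zero scalar part the powers above N vanish. *)
Definition tens_exp x : ttensor K N d :=
  \sum_(k < N.+1) (k`!%:R)^-1 *: x ^+ k.

Definition free_nilpotent_group : set (ttensor K N d) :=
  [set tens_exp x | x in lie_elt].

End FreeNilpotentGroup.

Arguments free_nilpotent_group : clear implicits.

Section Paths.
Context {R : realType}.
Implicit Types (a b s t p : R).

(* Subdivisions a = u_0 < ... < u_m = b are encoded, as in the library, by the
   list [:: u_1; ...; u_m]; c u v is the contribution of a subinterval. *)
Definition subdivision_sup a b (c : R -> R -> \bar R) : \bar R :=
  ereal_sup [set (let u := nth b (a :: l) in
                  \sum_(0 <= i < size l) c (u i) (u i.+1))%E
            | l in itv_partition a b].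

Definition pvariation p a b (c : R -> R -> \bar R) : \bar R :=
  poweR (subdivision_sup a b (fun u v => poweR (c u v) p)) p^-1.

Definition euclidean_norm d (v : 'rV[R]_d) : R :=
  Num.sqrt (\sum_(i < d) v 0 i ^+ 2).

Definition path_length d a b (x : R -> 'rV[R]_d) : \bar R :=
  subdivision_sup a b (fun u v => (euclidean_norm (x v - x u))%:E).

Definition C1var d a b (x : R -> 'rV[R]_d) : Prop :=
  {within `[a, b], continuous x} /\ (path_length a b x < +oo)%E.

Definition is_RSintegral a b (f g : R -> R) (I : R) : Prop :=
  forall e : R, 0 < e -> exists2 delta : R, 0 < delta &
    forall (l : seq R) (xi : nat -> R), itv_partition a b l ->
      let u := nth b (a :: l) in
      (forall i, (i < size l)%N ->
         u i.+1 - u i < delta /\ u i <= xi i <= u i.+1) ->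
      `|\sum_(0 <= i < size l) f (xi i) * (g (u i.+1) - g (u i)) - I| < e.

(* Riemann-Stieltjes integral of f against g over [a, b]; the value is the junk
   value 0 when the integral does not exist. *)
Definition RSintegral a b (f g : R -> R) : R :=
  xget 0 [set I | is_RSintegral a b f g I].

(* Iterated integral over s < u_1 < ... < u_k < t of dx^{i1}_{u_1} ...
   dx^{ik}_{u_k}; the word is read from its last letter, ik :: ... :: i1. *)
Fixpoint iterated_integral d (x : R -> 'rV[R]_d) s (w : seq 'I_d) t : R :=
  if w is i :: w' then
    RSintegral s t (iterated_integral x s w') (fun u => x u 0 i)
  else 1.

Definition signature N d (x : R -> 'rV[R]_d) s t : ttensor R N d :=
  [ffun w : N.-bseq 'I_d => iterated_integral x s (rev w) t].

(* The infimum is taken in the extended reals. *)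
Definition CCnorm N d (g : ttensor R N d) : \bar R :=
  ereal_inf [set path_length 0 1 x
            | x in [set x | C1var 0 1 x /\ signature N x 0 1 = g]].

Definition CCdist N d (g h : ttensor R N d) : \bar R := CCnorm (g^-1 * h).

Definition increment N d (X : R -> ttensor R N d) s t : ttensor R N d :=
  (X s)^-1 * X t.

Definition pvar_norm N d p s t (X : R -> ttensor R N d) : \bar R :=
  pvariation p s t (fun u v => CCnorm (increment X u v)).

Definition pvar_dist N d p s t (X Y : R -> ttensor R N d) : \bar R :=
  pvariation p s t (fun u v => CCdist (increment X u v) (increment Y u v)).

(* The topology of the truncated tensor algebra is that of a
   finite-dimensional space, so continuity is tested on coordinates. *)
Definition tens_continuous N d a b (X : R -> ttensor R N d) : Prop :=
  forall w : N.-bseq 'I_d, {within `[a, b], continuous (fun t => X t w : R)}.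

(* Paths are total functions on R, of which only the values on [0, T] matter.
   For 1 <= p, Num.truncn p is the integer part of p. *)
Definition geometric_rough_path d p (T : R)
    (X : R -> ttensor R (Num.truncn p) d) : Prop :=
  [/\ forall t, 0 <= t <= T ->
        free_nilpotent_group R (Num.truncn p) d (X t),
      tens_continuous 0 T X,
      X 0 = 1,
      (pvar_norm p 0 T X < +oo)%E
    & exists x : nat -> R -> 'rV[R]_d,
        (forall m, C1var 0 T (x m)) /\
        pvar_dist p 0 T (signature (Num.truncn p) (x m) 0) X
          @[m --> \oo] --> 0%E].

Definition concatenation N d (theta : R) (X1 X2 : R -> ttensor R N d)
    (t : R) : ttensor R N d :=
  if t < theta then increment X1 0 t
  else increment X1 0 theta * increment X2 theta t.

End Paths.

Arguments geometric_rough_path {R d} p T X.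

(* Main.v *)
Require Import Defs.
From mathcomp Require Import all_boot all_order all_algebra.
From mathcomp Require Import all_classical all_reals all_analysis.

Import Order.TTheory GRing.Theory Num.Theory.
Import numFieldNormedType.Exports.
Local Open Scope classical_set_scope.
Local Open Scope ring_scope.

(** The concatenation [X] coincides with [X1] up to [theta] and has the
    increments of [X2] afterwards.  Write [c u v] for the distance between the
    increments of [X] and [X1] over [u, v].

    If [u <= v <= theta], the two increments are equal, so [c u v] is the
    Carnot-Caratheodory norm of the unit, which is 0.  If [u <= theta <= v], both
    increments factor through [theta] with the same first factor, the increment
    of [X1] over [u, theta]; as the Carnot-Caratheodory distance is
    left-invariant, [c u v = c theta v].

    Hence a subdivision of [0, t] has the same sum as the subdivision of
    [theta, t] obtained by dropping the points up to [theta] and starting from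
    [theta] instead; and a subdivision of [theta, t] preceded by 0 has the same
    sum as before.  The two suprema are thus taken over the same set of sums
    ([subdivision_sup_shrink]).  The cancellations take place in the group of
    invertible tensors, to which the values of a rough path belong
    ([free_nilpotent_group_unit]). *)

(** * Invertible tensors *)

Section GroupElements.
Context {K : fieldType} {N d : nat}.
Implicit Types x g : ttensor K N d.

Lemma tcoef_sum I (r : seq I) (F : I -> ttensor K N d) w :
  tcoef (\sum_(i <- r) F i) w = \sum_(i <- r) tcoef (F i) w.
Proof.
elim/big_rec2: _ => [|i a g _ <-]; last by rewrite tcoefD.
by rewrite -[0 in LHS](scale0r (1 : ttensor K N d)) tcoefZ mul0r.
Qed.

Lemma lie_elt_scalar_part x : lie_elt x -> tcoef x [::] = 0.
Proof.
elim=> [v|a y z _ y0 _ z0|y z _ y0 _ z0].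
- by rewrite (tcoefE _ [bseq]) ffunE.
- by rewrite tcoefD tcoefZ y0 z0 mulr0 addr0.
by rewrite tcoefD -scaleN1r tcoefZ !tcoefM// !conv_nil y0 z0 !mulr0 addr0.
Qed.

(** The scalar part of an exponential of a Lie element is 1, and a truncated
    tensor is invertible as soon as its scalar part is nonzero. *)
Lemma free_nilpotent_group_unit g :
  free_nilpotent_group K N d g -> g \is a GRing.unit.
Proof.
case=> x Lx <-; have x0 := lie_elt_scalar_part _ Lx; change (tens_unit (tens_exp x)).
rewrite /tens_unit /tens_exp tcoef_sum big_ord_recl big1 => [|i _].
  by rewrite tcoefZ expr0 tcoef_one fact0 invr1 mulr1 addr0 oner_eq0.
by rewrite tcoefZ tcoefX_small ?mulr0.
Qed.

End GroupElements.

(** * The Carnot-Caratheodory norm of the unit *)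

Section CCnormOne.
Context {R : realType}.
Implicit Types (a b c : R) (l : seq R).

Lemma subdivision_sum_cons (c : R -> R -> \bar R) a b x l :
  (\sum_(0 <= i < size (x :: l))
     c (nth b [:: a, x & l] i) (nth b [:: a, x & l] i.+1) =
   c a x + \sum_(0 <= i < size l)
     c (nth b (x :: l) i) (nth b (x :: l) i.+1))%E.
Proof. by rewrite big_nat_recl. Qed.

Lemma fine_subdivision_unit_itv (delta : R) : 0 < delta ->
  exists2 l : seq R, itv_partition 0 1 l &
    forall i, (i < size l)%N ->
      nth 1 (0 :: l) i <= nth 1 (0 :: l) i.+1 < nth 1 (0 :: l) i + delta.
Proof.
move=> d0; pose n := Num.truncn delta^-1.
have nd : n.+1%:R^-1 < delta.
  rewrite invf_plt ?posrE// ?ltr0n//.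
  by rewrite truncnS_gt.
pose f i : R := i%:R / n.+1%:R.
have fS i : f i.+1 = f i + n.+1%:R^-1 by rewrite /f -natr1 mulrDl mul1r.
have nthf i : (i <= n.+1)%N -> nth 1 (0 :: mkseq (f \o succn) n.+1) i = f i.
  by case: i => [|i] i_n /=; [rewrite /f mul0r|rewrite nth_mkseq].
exists (mkseq (f \o succn) n.+1).
  split; last first.
    by rewrite (last_nth 1) size_mkseq nthf// /f divff// pnatr_eq0.
  apply/(pathP 1) => i; rewrite size_mkseq => i_n.
  by rewrite nthf 1?ltnW// nth_mkseq// -[ltRHS]/(f i.+1) fS ltrDl invr_gt0 ltr0n.
move=> i; rewrite size_mkseq => i_n; rewrite (nthf i.+1)// (nthf i (ltnW i_n)) fS.
by rewrite ltrD2l nd lerDl invr_ge0 ler0n.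
Qed.

(** All Riemann-Stieltjes sums against a constant vanish.  The integral is 0
    and not some other limit because arbitrarily fine subdivisions exist. *)
Lemma RSintegral_cst (f : R -> R) (k : R) : RSintegral 0 1 f (fun=> k) = 0.
Proof.
apply: xget_unique => [e e0|I HI].
  by exists 1 => // l xi _ /= _; rewrite subrr big1 ?subrr ?normr0// => i _;
     rewrite mulr0.
apply/eqP; rewrite -normr_eq0 eq_le normr_ge0 andbT.
apply/ler_addgt0Pr => e e0; rewrite add0r.
have [delta d0 Hd] := HI e e0.
have [l l01 lfine] := fine_subdivision_unit_itv _ d0.
have := Hd l (nth 1 (0 :: l)) l01.
rewrite subrr big1 ?sub0r ?normrN => [H|i _]; last by rewrite mulr0.
apply/ltW/H => i /lfine /andP[le_i lt_i].
by rewrite ltrBlDl lt_i lexx le_i.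
Qed.

Lemma signature_cst N d (v : 'rV[R]_d) : signature N (fun=> v) 0 1 = 1.
Proof.
apply/ffunP => w; rewrite !ffunE.
have := size_rev w; case: (rev w) => [|i s] /= <- //.
exact: RSintegral_cst.
Qed.

Lemma path_length_ge0 d a b (x : R -> 'rV[R]_d) : a < b ->
  (0 <= path_length a b x)%E.
Proof.
move=> ab; apply: ereal_sup_ge; eexists.
  by exists [:: b]; [exact: itv_partition1|reflexivity].
by rewrite /= big_nat1 lee_fin sqrtr_ge0.
Qed.

Lemma path_length_cst d a b (v : 'rV[R]_d) : a < b ->
  path_length a b (fun=> v) = 0%E.
Proof.
move=> ab; apply/eqP; rewrite eq_le path_length_ge0// andbT.
apply: ge_ereal_sup => _ [l _ <-]; rewrite big1// => i _.
rewrite /euclidean_norm subrr big1 ?sqrtr0// => j _.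
by rewrite mxE expr0n.
Qed.

(** The infimum is attained by a constant path. *)
Lemma CCnorm1 N d : CCnorm (1 : ttensor R N d) = 0%E.
Proof.
apply/eqP; rewrite eq_le; apply/andP; split.
  apply: ereal_inf_lbound; exists (fun=> 0); last exact: path_length_cst.
  split; last exact: signature_cst.
  split; last by rewrite path_length_cst.
  by move=> t; exact: cvg_cst.
by apply: le_ereal_inf_tmp => _ [x _ <-]; exact: path_length_ge0.
Qed.

Lemma CCdistMl N d (k g h : ttensor R N d) :
  k \is a GRing.unit -> g \is a GRing.unit ->
  CCdist (k * g) (k * h) = CCdist g h.
Proof. by move=> ku gu; rewrite /CCdist invrM// -mulrA mulKr. Qed.

Lemma CCdistxx N d (g : ttensor R N d) : g \is a GRing.unit ->
  CCdist g g = 0%E.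
Proof. by move=> gu; rewrite /CCdist mulVr// CCnorm1. Qed.

Lemma incrementM N d (X : R -> ttensor R N d) s u t : X u \is a GRing.unit ->
  increment X s t = increment X s u * increment X u t.
Proof. by move=> Xu; rewrite /increment -mulrA mulVKr. Qed.

Lemma increment_unit N d (X : R -> ttensor R N d) s t :
  X s \is a GRing.unit -> X t \is a GRing.unit ->
  increment X s t \is a GRing.unit.
Proof. by move=> Xs Xt; rewrite unitrMl// unitrV. Qed.

End CCnormOne.

(** * Suprema over subdivisions *)

Section Shrink.
Context {R : realType}.
Variables (a m b : R) (c : R -> R -> \bar R).
Hypotheses (am : a < m) (mb : m < b).
Hypothesis c0 : forall u v, a <= u -> u <= v -> v <= m -> c u v = 0%E.
Hypothesis cm : forall u v, a <= u -> u <= m -> m <= v -> v <= b ->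
  c u v = c m v.

(** Dropping from a subdivision the points up to [m] does not change its sum,
    even if [m] is not one of its points: the interval that straddles [m]
    contributes as much as its part after [m]. *)
Lemma subdivision_sum_drop a' l : a <= a' -> a' <= m ->
  itv_partition a' b l ->
  exists2 l', itv_partition m b l' &
    (\sum_(0 <= i < size l') c (nth b (m :: l') i) (nth b (m :: l') i.+1) =
     \sum_(0 <= i < size l) c (nth b (a' :: l) i) (nth b (a' :: l) i.+1))%E.
Proof.
elim: l a' => [|x l IH] a' aa' a'm [].
  by move=> _ /= /eqP a'b; move: mb; rewrite ltNge -a'b a'm.
move=> /= /andP[a'x xl] lastl.
rewrite subdivision_sum_cons; have [xm|mx] := leP x m.
  have [] := IH x _ xm; rewrite ?(le_trans aa' (ltW a'x))//.
  move=> l' ml' El'; exists l' => //; rewrite c0// ?add0e//; exact: ltW.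
have xb : x <= b.
  by apply: itv_partition_le; split; [exact: xl|exact: lastl].
exists (x :: l); first by split => //=; rewrite mx.
by rewrite subdivision_sum_cons (cm a')// ltW.
Qed.

Lemma subdivision_sup_shrink : subdivision_sup a b c = subdivision_sup m b c.
Proof.
rewrite /subdivision_sup; congr ereal_sup; apply/seteqP; split=> _ [l Pl <-].
  have [l' Pl' El'] := subdivision_sum_drop _ _ (lexx a) (ltW am) Pl.
  by exists l'.
exists (m :: l); last by rewrite subdivision_sum_cons c0 ?add0e// ltW.
by case: Pl => ml lb; split => //=; rewrite am.
Qed.

End Shrink.

Lemma pvariation_shrink {R : realType} (p a m b : R) (c : R -> R -> \bar R) :
  p != 0 -> a < m -> m < b ->
  (forall u v, a <= u -> u <= v -> v <= m -> c u v = 0%E) ->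
  (forall u v, a <= u -> u <= m -> m <= v -> v <= b -> c u v = c m v) ->
  pvariation p a b c = pvariation p m b c.
Proof.
move=> p0 am mb c0 cm; rewrite /pvariation (subdivision_sup_shrink _ m)//.
- by move=> u v au uv vm; rewrite c0// poweR0r.
- by move=> u v au um mv vb; rewrite cm.
Qed.

(** * The concatenated path *)

Section Concatenation.
Context {R : realType} {N d : nat}.
Variables (theta : R) (X1 X2 : R -> ttensor R N d).
Hypotheses (X10 : X1 0 = 1) (X2u : X2 theta \is a GRing.unit).

Lemma concatenation_le u : u <= theta -> concatenation theta X1 X2 u = X1 u.
Proof.
rewrite /concatenation /increment X10 invr1 !mul1r le_eqVlt.
case/predU1P => [->|->//].
by rewrite ltxx mulVr ?mulr1.
Qed.

Lemma concatenation_unit v : X1 theta \is a GRing.unit ->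
  X2 v \is a GRing.unit -> theta <= v ->
  concatenation theta X1 X2 v \is a GRing.unit.
Proof.
move=> X1u X2v; rewrite /concatenation leNgt => /negbTE ->.
by rewrite unitrMl increment_unit// X10 unitr1.
Qed.

End Concatenation.

Theorem lemma3p7 (R : realType) (d : nat) (p T : R)
    (X1 X2 : R -> ttensor R (Num.truncn p) d) (theta : R) :
  (1 <= d)%N -> 1 <= p -> 0 < T -> 0 <= theta ->
  geometric_rough_path p T X1 -> geometric_rough_path p T X2 ->
  forall t : R, theta < t -> t <= T ->
  pvar_dist p 0 t (concatenation theta X1 X2) X1 =
  pvar_dist p theta t (concatenation theta X1 X2) X1.
Proof.
move=> _ p1 _ theta0 [G1 _ X10 _ _] [G2 _ _ _ _] t theta_t tT.
have [->//|theta_neq0] := eqVneq theta 0.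
have theta_gt0 : 0 < theta by rewrite lt_neqAle eq_sym theta_neq0.
have thetaT : theta <= T by exact: le_trans (ltW theta_t) tT.
have U1 u : 0 <= u -> u <= T -> X1 u \is a GRing.unit.
  by move=> u0 uT; apply: free_nilpotent_group_unit; apply: G1; rewrite u0.
have U2 u : 0 <= u -> u <= T -> X2 u \is a GRing.unit.
  by move=> u0 uT; apply: free_nilpotent_group_unit; apply: G2; rewrite u0.
have X2u := U2 _ theta0 thetaT; have X1u := U1 _ theta0 thetaT.
have p0 : p != 0 by rewrite gt_eqF// (lt_le_trans ltr01).
apply: (pvariation_shrink _ _ _ _ _ p0 theta_gt0 theta_t)
  => [u v u0 uv v_le|u v u0 u_le le_v vt].
  have vT := le_trans v_le thetaT.
  rewrite /increment !concatenation_le ?(le_trans uv)//.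
  rewrite CCdistxx//.
  by rewrite increment_unit ?U1// ?(le_trans u0) ?(le_trans uv).
have uT := le_trans u_le thetaT.
set X := concatenation theta X1 X2.
have Xtheta : X theta = X1 theta by exact: concatenation_le.
have Xv : X v \is a GRing.unit.
  by apply: concatenation_unit => //; apply: U2;
    rewrite ?(le_trans theta0)// (le_trans vt).
(* Both increments over [u, v] are split at theta, with a common first factor. *)
have Xu_theta : increment X u theta = increment X1 u theta.
  by rewrite /increment Xtheta /X concatenation_le.
have -> : increment X u v = increment X1 u theta * increment X theta v.
  by rewrite -Xu_theta; apply: incrementM; rewrite Xtheta.
rewrite (incrementM _ _ X1 u theta v X1u).
apply: CCdistMl; apply: increment_unit; first exact: U1.
- exact: X1u.
- by rewrite Xtheta.
exact: Xv.
Qed.
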